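(* Let $R$ be a commutative ring with unity, let $n,\alpha\ge 2$ be integers, and let $A\in M_n(R)$ be similar over $R$ to $\mathrm{diag}(\lambda_1,\dots,\lambda_n)$, with $\lambda_1,\dots,\lambda_n\in R$ such that, for every $i\neq j$, $\lambda_i-\lambda_j$ is not a zero-divisor in $R$. Assume that $n!$ is not a zero-divisor in $R$. If $X\in M_n(R)$ is a solution of $$AX-XA=X^{\alpha},$$ then there is $P\in GL_n(R)$ such that $A=P\,\mathrm{diag}(\lambda_1,\dots,\lambda_n)\,P^{-1}$ and $X=P\,\mathrm{diag}(\mu_1,\dots,\mu_n)\,P^{-1}$ with $\mu_1,\dots,\mu_n\in R$ and $\mu_i^{\alpha}=0$ for every $i$.
   Context: An element $z$ of a commutative ring $R$ is ''not a zero-divisor'' if $zr=0$ with $r\in R$ implies $r=0$; $n!$ is understood as $n!\cdot 1_R$. Two matrices $A,D\in M_n(R)$ are similar over $R$ if $A=PDP^{-1}$ for some $P\in GL_n(R)$. *)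

(* Defs.v *)
From mathcomp Require Import all_boot all_order all_algebra.
Set Implicit Arguments.
Unset Strict Implicit.
Unset Printing Implicit Defensive.
Import GRing.Theory.
Local Open Scope ring_scope.

(* Only commutativity and a unit element are assumed of the ring: the zero
   ring is allowed and no decidability of units is required, so that GL_n(R)
   is expressed by explicit two-sided inverses rather than by unitmx. *)
Definition not_zero_divisor (R : comPzRingType) (z : R) : Prop :=
  forall r : R, z * r = 0 -> r = 0.

Definition inverse_mx (R : comPzRingType) (n : nat) (P Q : 'M[R]_n) : Prop :=
  P *m Q = 1%:M /\ Q *m P = 1%:M.

Definition similar_over (R : comPzRingType) (n : nat) (A D : 'M[R]_n) : Prop :=
  exists P Q : 'M[R]_n, inverse_mx P Q /\ A = P *m D *m Q.

(* Main.v *)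
Require Import Defs.
From HB Require Import structures.
From mathcomp Require Import all_boot all_order all_algebra.
Set Implicit Arguments.
Unset Strict Implicit.
Unset Printing Implicit Defensive.
Import GRing.Theory.
Local Open Scope ring_scope.

(** Conjugating by the matrix that diagonalises A, one may take A to be
    D = diag(lambda) and must show that a solution Y of [D, Y] = Y^alpha is
    diagonal: it then commutes with D, so Y^alpha = 0, and the same P serves
    for A and X. There are two steps.

    Y is nilpotent. Since [D, Y] commutes with Y, the commutator with D acts
    on R[Y] as the derivation t^alpha d/dt ([commutator_horner_mx]). Applied
    n times to the relation p(Y) = 0, where p is the characteristic
    polynomial, it gives p^(n)(Y) Y^(n alpha) = 0. As p is monic of degree n,
    this reads n! Y^(n alpha) = 0 ([factorial_mul_expr_mx_eq0]), and n! can be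
    cancelled.

    Y is diagonal. The same derivation gives [D, Y^k] = k Y^(k + alpha - 1).
    The (i, j) entry of [D, Z] is (lambda_i - lambda_j) Z_ij, so Z is diagonal
    as soon as [D, Z] is. Hence Y^k is diagonal as soon as
    Y^(k + alpha - 1) is. High powers of Y vanish, and because alpha >= 2 the
    exponent can be brought down to k = 1
    ([is_diag_mx_commutator_eq_expr_nz]). *)

(** * The commutator as a derivation, and nilpotency *)

(** As [A, X] is a power of X, it commutes with X, so the Leibniz rule for the
    commutator with A turns into the chain rule on polynomials in X. *)
Lemma commutator_horner_mx (R : comNzRingType) (m a : nat) (A X : 'M[R]_m.+1)
    (q : {poly R}) :
  A * X - X * A = X ^+ a ->
  A * horner_mx X q - horner_mx X q * A = horner_mx X (q^`() * 'X^a).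
Proof.
move=> hX; elim/poly_ind: q => [|q c IHq].
  by rewrite deriv0 mul0r !rmorph0 mulr0 mul0r subrr.
have cA : A * c%:M = c%:M * A by apply: comm_mx_scalar.
move: IHq; rewrite derivMXaddC !(rmorphD, rmorphM, rmorphXn) /=.
rewrite horner_mx_X horner_mx_C => IHq.
rewrite [RHS]mulrDl -[_ * X * _]mulrA -exprS exprSr [_ * (_ * X)]mulrA -IHq -hX.
rewrite !(mulrDl, mulrDr) cA opprD addrACA subrr addr0.
by rewrite mulrN mulNr !mulrA [RHS]addrC addrA subrK.
Qed.

(** Differentiating the Cayley-Hamilton relation: each commutator with A lowers
    the degree of the polynomial by one at the cost of a factor X^(a.+1), until
    only the constant n! is left. This replaces the usual argument by traces of
    powers and Newton's identities. *)
Lemma factorial_mul_expr_mx_eq0 (R : comNzRingType) (m a : nat)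
    (A X : 'M[R]_m.+1) :
  A * X - X * A = X ^+ a.+1 -> X ^+ (m.+1 * a.+1) *+ m.+1`! = 0.
Proof.
move=> hX; pose p := char_poly X.
have root_derivn k : horner_mx X (p^`(k) * 'X^(k * a.+1)) = 0.
  elim: k => [|k IHk]; first by rewrite mulr1; apply: Cayley_Hamilton.
  set q := p^`(k) * _ in IHk.
  (* Differentiating the factor 'X^(k * a.+1) yields an extra term, which is
     again a multiple of q and hence dies at X. *)
  have dq : q^`() * 'X^(a.+1)
    = p^`(k.+1) * 'X^(k.+1 * a.+1) + q * 'X^a *+ (k * a.+1).
    rewrite /q derivM mulrDl derivXn derivnS -mulrA -exprD addnC -mulSn.
    congr (_ + _); rewrite -!mulrA -mulrnAr mulrnAl -!exprD; congr (_ * _).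
    by case: (k * a.+1)%N => [|j]; rewrite ?mulr0n //= addSnnS.
  have := commutator_horner_mx q hX.
  have q0 : horner_mx X (q * 'X^a *+ (k * a.+1)) = 0.
    by rewrite rmorphMn rmorphM /= IHk mul0r mul0rn.
  by rewrite dq rmorphD /= q0 addr0 IHk mulr0 mul0r subrr.
have pn : p^`(m.+1) = (m.+1`!)%:R.
  apply/polyP=> i; rewrite coef_derivn -polyC_natr coefC.
  have sp := size_char_poly X; case: i => [|i] /=.
    have /monicP := char_poly_monic X.
    by rewrite lead_coefE sp addn0 ffactnn => ->.
  by rewrite nth_default ?mul0rn // sp addnS ltnS leq_addr.
have := root_derivn m.+1.
by rewrite pn mulr_natl rmorphMn rmorphXn /= horner_mx_X.
Qed.

(** * Descent to diagonality *)

Lemma commutator_diag_mx (R : comPzRingType) (n : nat) (d : 'rV[R]_n)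
    (Y : 'M[R]_n) (i j : 'I_n) :
  (diag_mx d *m Y - Y *m diag_mx d) i j = (d 0 i - d 0 j) * Y i j.
Proof.
by rewrite mul_diag_mx mul_mx_diag !mxE mulrBl [Y i j * _]mulrC.
Qed.

Lemma is_diag_mx_commutator (R : comPzRingType) (n : nat) (d : 'rV[R]_n)
    (Y : 'M[R]_n) :
  (forall i j : 'I_n, i <> j -> not_zero_divisor (d 0 i - d 0 j)) ->
  is_diag_mx (diag_mx d *m Y - Y *m diag_mx d) -> is_diag_mx Y.
Proof.
move=> hd /is_diag_mxP hY; apply/is_diag_mxP => i j neq_ij.
apply: (hd i j) => [eq_ij|]; first by rewrite eq_ij eqxx in neq_ij.
by rewrite -commutator_diag_mx hY.
Qed.

Lemma is_diag_mx_commutator_eq_expr_nz (R : comNzRingType) (m a : nat)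
    (d : 'rV[R]_m.+1) (Y : 'M[R]_m.+1) :
  (forall i j : 'I_m.+1, i <> j -> not_zero_divisor (d 0 i - d 0 j)) ->
  not_zero_divisor ((m.+1`!)%:R : R) ->
  diag_mx d * Y - Y * diag_mx d = Y ^+ a.+2 -> is_diag_mx Y.
Proof.
move=> hd hfact hY.
have nilY : Y ^+ (m.+1 * a.+2) = 0.
  apply/matrixP => i j; rewrite [RHS]mxE; apply: hfact.
  by rewrite mulr_natl -mulmxnE (factorial_mul_expr_mx_eq0 hY) mxE.
(* [D, Y^(k.+1)] is a multiple of Y^(k.+1 + a.+1). *)
have step k : is_diag_mx (Y ^+ (k.+1 + a.+1)) -> is_diag_mx (Y ^+ k.+1).
  move=> /is_diag_mxP diagS; apply: (is_diag_mx_commutator hd).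
  have := commutator_horner_mx 'X^(k.+1) hY.
  rewrite derivXn mulrnAl -exprD rmorphMn !rmorphXn /= horner_mx_X !mulmxE => ->.
  by apply/is_diag_mxP => i j ij; rewrite mulmxnE -addSnnS diagS ?mul0rn.
have large k : (m.+1 * a.+2 <= k)%N -> is_diag_mx (Y ^+ k).
  by move=> /subnK <-; rewrite exprD nilY mulr0 mx0_is_diag.
(* t bounds the number of descents left; each of them gains a.+1 >= 1. *)
have all_pos t k : (m.+1 * a.+2 <= k.+1 + t)%N -> is_diag_mx (Y ^+ k.+1).
  elim: t k => [|t IHt] k le_k; first by apply: large; rewrite addn0 in le_k.
  apply: step; rewrite addSn; apply: IHt.
  by apply: leq_trans le_k _; rewrite !addnS !addSn !ltnS -addnA leq_add2l leq_addl.
by rewrite -[Y]expr1; apply: (all_pos (m.+1 * a.+2)%N); rewrite leq_addl.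
Qed.

(** Characteristic polynomials live over a nonzero ring; over the zero ring all
    matrices are diagonal, which separates the two cases. *)
Lemma is_diag_mx_commutator_eq_expr (R : comPzRingType) (n alpha : nat)
    (d : 'rV[R]_n) (Y : 'M[R]_n) :
  (2 <= alpha)%N ->
  (forall i j : 'I_n, i <> j -> not_zero_divisor (d 0 i - d 0 j)) ->
  not_zero_divisor ((n`!)%:R : R) ->
  diag_mx d *m Y - Y *m diag_mx d = Y ^+ alpha -> is_diag_mx Y.
Proof.
have [R0 | nzR] := eqVneq (1 : R) 0.
  by move=> *; apply/is_diag_mxP => i j _; rewrite -[LHS]mul1r R0 mul0r.
pose R' : comNzRingType :=
  HB.pack (GRing.ComPzRing.sort R) (GRing.PzSemiRing_isNonZero.Build R nzR).
case: n d Y => [|m] d Y; first by move=> *; apply/is_diag_mxP => -[].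
case: alpha => [|[|a]] // _ hd hfact hY.
exact: (@is_diag_mx_commutator_eq_expr_nz R' m a d Y hd hfact hY).
Qed.

Lemma expr_diag_mx (R : pzSemiRingType) (n : nat) (d : 'rV[R]_n) (k : nat) :
  diag_mx d ^+ k = diag_mx (\row_j d 0 j ^+ k).
Proof.
elim: k => [|k IHk].
  by apply/matrixP => i j; rewrite !mxE expr0.
rewrite exprS IHk -mulmxE mulmx_diag; congr diag_mx.
by apply/rowP => j; rewrite !mxE exprS.
Qed.

Theorem theorem1 (R : comPzRingType) (n alpha : nat)
  (hn : (2 <= n)%N) (halpha : (2 <= alpha)%N)
  (A : 'M[R]_n) (lambda : 'rV[R]_n)
  (hA : similar_over A (diag_mx lambda))
  (hlambda : forall i j : 'I_n, i <> j ->
     not_zero_divisor (lambda ord0 i - lambda ord0 j))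
  (hfact : not_zero_divisor ((n`!)%:R : R))
  (X : 'M[R]_n)
  (hX : A *m X - X *m A = X ^+ alpha) :
  exists (P Pinv : 'M[R]_n) (mu : 'rV[R]_n),
    [/\ inverse_mx P Pinv,
        A = P *m diag_mx lambda *m Pinv,
        X = P *m diag_mx mu *m Pinv
      & forall i : 'I_n, mu ord0 i ^+ alpha = 0].
Proof.
have [P [Q [[PQ QP] eqA]]] := hA; pose Y := Q *m X *m P.
have eqX : X = P *m Y *m Q.
  by rewrite /Y !mulmxA PQ mul1mx -mulmxA PQ mulmx1.
have powY k : Y ^+ k = Q *m X ^+ k *m P.
  elim: k => [|k IHk]; first by rewrite !expr0 mulmx1 QP.
  rewrite !exprS IHk -!mulmxE /Y -!mulmxA; congr (_ *m (_ *m _)).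
  by rewrite !mulmxA PQ mul1mx.
have hY : diag_mx lambda *m Y - Y *m diag_mx lambda = Y ^+ alpha.
  have -> : diag_mx lambda = Q *m A *m P.
    by rewrite eqA !mulmxA QP mul1mx -mulmxA QP mulmx1.
  rewrite powY -hX mulmxBr mulmxBl /Y -!mulmxA.
  by rewrite !(mulmxA P Q) PQ !mul1mx.
have diagY := is_diag_mx_commutator_eq_expr halpha hlambda hfact hY.
have [mu eqY] := diag_mxP _ diagY.
exists P, Q, mu; split=> // [|i]; first by rewrite -eqY.
have : (Y ^+ alpha) i i = 0 by rewrite -hY commutator_diag_mx subrr mul0r.
by rewrite eqY expr_diag_mx !mxE eqxx.
Qed.
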